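(* The conga line data structure (defined in the context) maintains the closest pair of a dynamic set $S$ of objects, under insertions and deletions of objects, in $O(n)$ space, amortized time $O(n\log n)$ per insertion, and amortized time $O(n\log^2 n)$ per deletion, where $n=|S|$.
   Context: Model of computation: $S$ is a finite set of objects subject to insertions and deletions, together with a (symmetric) bivariate function $d(s,t)$ giving the distance between two objects. The values of $d$ are only assumed to be totally ordered; no triangle inequality or other property is assumed. Each object is stored in constant space, $d$ can be evaluated in constant time, and two distances can be compared in constant time. The closest pair is a pair of distinct objects $s,t\in S$ minimizing $d(s,t)$; if several pairs attain the minimum, any one of them may be returned. Throughout $n=|S|$ and $\log$ is the base-2 logarithm. Amortized bounds mean that, for every sequence of updates performed after initialization, the total time of the updates is at most the sum of the stated bounds over the updates. Conga line data structure: it consists of a partition of $S$ into $k\le\log n$ subsets $S_1,\dots,S_k$, together with a digraph $G_i$ for each $S_i$; each $G_i$ is a union of vertex-disjoint directed paths on objects of $S$ (edges of $G_i$ need not have an endpoint in $S_i$). The closest pair is reported by scanning all edges of all the graphs $G_i$ and returning an edge whose endpoints are at minimum distance. Creating $G_i$ for a subset $S_i$: $G_i$ is initially a single directed path $P$, whose first vertex is any object of $S_i$, extended one edge at a time. If the current last vertex of $P$ belongs to $S_i$, the next vertex is its nearest neighbor in $S\setminus P$; if the current last vertex belongs to $S\setminus S_i$, the next vertex is its nearest neighbor in $S_i\setminus P$. This continues until the path cannot be extended because the relevant set ($S\setminus P$ or $S_i\setminus P$) is empty. Nearest neighbors are found by testing all candidate objects. Merging: while $k>\log n$, choose two subsets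 $S_i,S_j$ with $|S_i|\le|S_j|$ minimizing the ratio $|S_j|/|S_i|$, replace them by the single subset $S_i\cup S_j$, and replace their graphs by a newly created graph for the merged subset. Initialization: put all initial objects in $S_1$ and create $G_1$. Insertion of $x$: create a new subset $S_{k+1}=\{x\}$, create $G_{k+1}$, and merge as necessary until $k\le\log n$. Deletion of $x$: move to a new subset $S_{k+1}$ all objects $y$ such that $(y,x)$ is a directed edge in some $G_i$ (removing them from their previous subsets); remove $x$ and all its adjacent edges from all the graphs $G_i$; create $G_{k+1}$ for $S_{k+1}$; and merge as necessary until $k\le\log n$. Rebuilding: whenever the total number of edges in all graphs grows to $2n$, rebuild the structure by moving all objects to $S_1$ and recomputing $G_1$. *)

(* Defs.v *)
From mathcomp Require Import all_boot all_order all_algebra.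

Set Implicit Arguments.
Unset Strict Implicit.
Unset Printing Implicit Defensive.

Declare Scope comp_scope.
Delimit Scope comp_scope with comp.

(* A nondeterministic computation, given by its total-correctness semantics:
   [m Q] states that, however the choices in [m] are resolved, [m] terminates
   without getting stuck, with a result [a], a running time [t] and a peak
   number [w] of words of memory in use, such that [Q a t w]. *)
Definition comp (A : Type) := (A -> nat -> nat -> Prop) -> Prop.

Definition ret A (a : A) : comp A := fun Q => Q a 0 0.

Definition bind A B (m : comp A) (f : A -> comp B) : comp B :=
  fun Q => m (fun a t w => f a (fun b t' w' => Q b (t + t') (maxn w w'))).

Definition tick (t : nat) : comp unit := fun Q => Q tt t 0.

(* Records that [w] words are in use at this point. *)
Definition hold (w : nat) : comp unit := fun Q => Q tt 0 w.

(* Runs [m] while [w] further words remain in use. *)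
Definition frame A (w : nat) (m : comp A) : comp A :=
  fun Q => m (fun a t w' => Q a t (w + w')).

(* An arbitrary element satisfying [P]; the cost of finding it is charged
   separately. *)
Definition choose A (P : A -> Prop) : comp A :=
  fun Q => (exists a, P a) /\ (forall a, P a -> Q a 0 0).

(* [step] is repeated until it returns [inr]. As [iterate 0] satisfies no
   postcondition, [loop step a Q] includes termination on every branch. *)
Fixpoint iterate (n : nat) A B (step : A -> comp (A + B)) (a : A) : comp B :=
  if n is n'.+1 then
    bind (step a) (fun r => match r with
                            | inl a' => iterate n' step a'
                            | inr b => ret b
                            end)
  else fun=> False.

Definition loop A B (step : A -> comp (A + B)) (a : A) : comp B :=
  fun Q => exists n, iterate n step a Q.

Notation "'let*' x := m 'in' k" := (bind m (fun x => k))
  (at level 200, x strict pattern, k at level 200) : comp_scope.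
Notation "m ;; k" := (bind m (fun _ : unit => k))
  (at level 199, right associativity) : comp_scope.
Local Open Scope comp_scope.

Local Notation log n := (trunc_log 2 n).

(* f = O(g) as n tends to infinity *)
Definition bigO (f g : nat -> nat) :=
  exists C n0, forall n, n0 <= n -> f n <= C * g n.

(* Sets are stored as linked lists without repetition. [scan s] is the time of
   a traversal of [s] with constant time spent on each cell. *)
Definition scan A (s : seq A) : comp unit := tick (size s).+1.

Section CongaLine.

Context {T : eqType} {disp : Order.disp_t} {D : orderType disp}.
Variable d : T -> T -> D.

Definition remove (x : T) (s : seq T) : comp (seq T) :=
  scan s;; ret [seq y <- s | y != x].

(* Every candidate is tested: one evaluation of [d] and one comparison each. *)
Definition nearest (u : T) (s : seq T) : comp T :=
  scan s;;
  choose (fun v => v \in s /\ forall w, w \in s -> (d u v <= d u w)%O).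

(* A directed graph is stored as the list of its edges. *)
Definition digraph := seq (T * T).

(* The state of a path P under construction for a subset Si of S. *)
Record walk := Walk {
  wlast : T;           (* last vertex of P *)
  wfree : seq T;       (* S \ P *)
  wfreei : seq T;      (* Si \ P *)
  wedges : digraph     (* edges of P *)
}.

Definition extend (Si : seq T) (P : walk) : comp (walk + digraph) :=
  hold (size Si + size (wfree P) + size (wfreei P) + size (wedges P)).+1;;
  scan Si;;
  let candidates := if wlast P \in Si then wfree P else wfreei P in
  if candidates is [::] then ret (inr (wedges P)) else
  let* v := nearest (wlast P) candidates in
  let* free := remove v (wfree P) in
  let* freei := remove v (wfreei P) in
  ret (inl (Walk v free freei ((wlast P, v) :: wedges P))).

Definition new_graph (S Si : seq T) : comp digraph :=
  tick 1;;
  if Si is [::] then ret [::] else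
  let* x := choose (fun x => x \in Si) in
  let* free := remove x S in
  let* freei := remove x Si in
  loop (extend Si) (Walk x free freei [::]).

(* A class S_i of the partition together with its graph G_i. *)
Definition part := (seq T * digraph)%type.

(* Classes of the partition are nonempty: a class that becomes empty is
   discarded with its graph. *)
Definition nonempty (ps : seq part) : seq part := [seq p <- ps | p.1 != [::]].

Definition all_edges (ps : seq part) : digraph := flatten [seq p.2 | p <- ps].

Definition words (S : seq T) (ps : seq part) : nat :=
  (size S + \sum_(p <- ps) (size p.1 + size p.2).+1).+1.

Definition ratio (p q : part) : rat :=
  ((size q.1)%:R / (size p.1)%:R)%R.

(* When |S| = 1 the number of classes cannot be brought down to log |S| = 0;
   merging then stops at a single class. *)
Definition merge_step (S : seq T) (ps : seq part)
    : comp (seq part + seq part) :=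
  hold (words S ps);;
  scan S;; scan ps;;
  if ~~ ((log (size S) < size ps) && (1 < size ps)) then ret (inr ps) else
  (* the sizes are computed, then all pairs of classes are compared *)
  tick (\sum_(p <- ps) (size p.1).+1);;
  tick (size ps ^ 2);;
  let* (p, q, ps') := choose (fun '(p, q, ps') =>
    [/\ perm_eq ps [:: p, q & ps'],
        size p.1 <= size q.1
      & forall p1 q1 ps1, perm_eq ps [:: p1, q1 & ps1] ->
          size p1.1 <= size q1.1 -> (ratio p q <= ratio p1 q1)%R]) in
  let Sij := p.1 ++ q.1 in
  scan Sij;;
  let* G := frame (words S ps) (new_graph S Sij) in
  ret (inl ((Sij, G) :: ps')).

Definition merge (S : seq T) : seq part -> comp (seq part) :=
  loop (merge_step S).

Definition single_part (S : seq T) : comp (seq part) :=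
  scan S;;
  let* G := frame (words S [:: (S, [::])]) (new_graph S S) in
  ret (nonempty [:: (S, G)]).

Definition rebuild_if_needed (S : seq T) (ps : seq part) : comp (seq part) :=
  scan S;; scan ps;; scan (all_edges ps);;
  if 2 * size S <= size (all_edges ps) then single_part S else ret ps.

Record state := State {
  objects : seq T;
  parts : seq part;
  closest : option (T * T)   (* the pair last reported *)
}.

Definition report (S : seq T) (ps : seq part) : comp state :=
  hold (words S ps);;
  scan ps;; scan (all_edges ps);;
  if all_edges ps is [::] then ret (State S ps None) else
  let* e := choose (fun e => e \in all_edges ps /\
    forall e', e' \in all_edges ps -> (d e.1 e.2 <= d e'.1 e'.2)%O) in
  ret (State S ps (Some e)).

Definition init (S : seq T) : comp state :=
  let* ps := single_part S in report S ps.

Definition finish (S : seq T) (ps : seq part) : comp state :=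
  let* ps1 := merge S ps in
  let* ps2 := rebuild_if_needed S ps1 in
  report S ps2.

Definition insert (x : T) (st : state) : comp state :=
  let S := x :: objects st in
  let ps := parts st in
  tick 1;;
  let* G := frame (words S ps) (new_graph S [:: x]) in
  finish S (([:: x], G) :: ps).

Definition delete (x : T) (st : state) : comp state :=
  let ps := parts st in
  (* [ys] may repeat an object that precedes [x] in several graphs *)
  let ys := [seq e.1 | e <- all_edges ps & e.2 == x] in
  scan ps;; scan (all_edges ps);;
  let Y := undup ys in
  tick (size ys ^ 2);;
  hold (words (objects st) ps + size ys);;
  let* S' := remove x (objects st) in
  let ps1 := [seq ([seq y <- p.1 | (y != x) && (y \notin Y)],
                   [seq e <- p.2 | (e.1 != x) && (e.2 != x)]) | p <- ps] in
  (* each stored object is searched in [Y], each stored edge compared to [x] *)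
  tick (\sum_(p <- ps) (size p.1 * (size Y).+2 + size p.2).+2);;
  let* G := frame (words S' ps1) (new_graph S' Y) in
  finish S' (nonempty ((Y, G) :: ps1)).

Inductive operation := Insert of T | Delete of T.

Definition update (u : operation) : state -> comp state :=
  match u with Insert x => insert x | Delete x => delete x end.

Fixpoint updates (us : seq operation) (st : state) : comp state :=
  if us is u :: us' then let* st' := update u st in updates us' st'
  else ret st.

(* The abstract set of objects, independently of the data structure. *)
Definition apply (S : seq T) (u : operation) : seq T :=
  match u with Insert x => x :: S | Delete x => rem x S end.

Definition admissible (S : seq T) (u : operation) : bool :=
  match u with Insert x => x \notin S | Delete x => x \in S end.

Fixpoint all_admissible (S : seq T) (us : seq operation) : bool :=
  if us is u :: us' then admissible S u && all_admissible (apply S u) us'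
  else true.

(* Sum over the updates of [ins n] or [del n], n = |S| before the update. *)
Fixpoint budget (ins del : nat -> nat) (S : seq T) (us : seq operation) : nat :=
  if us is u :: us' then
    (if u is Insert _ then ins (size S) else del (size S))
    + budget ins del (apply S u) us'
  else 0.

Definition is_closest_pair (S : seq T) (r : option (T * T)) : Prop :=
  if r is Some (s, t) then
    [/\ s \in S, t \in S, s != t
      & forall s' t', s' \in S -> t' \in S -> s' != t' -> (d s t <= d s' t')%O]
  else size S <= 1.

End CongaLine.

(* Main.v *)
(* Coverage. A path built for a class Si passes through all of Si, and whichever
   of x in Si and y in S it meets first, its next edge (u, v) satisfies
   u in {x, y} and d u v <= d x y. So of the graphs of the classes of x and y the
   one created last contains such an edge; it can only be lost by deleting v, and
   then u moves to a class with a new graph. Hence the closest pair is an edge.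

   Time. A graph for Si is built in O(n (|Si| + 1)) steps. When there are more than
   log n classes, two of them have sizes a <= b <= 4a, so the cheapest merge costs
   O(n a). With F(m) = sum_(j <= m) log j, the quantity sum_i F(|Si|) grows by at
   least a at each merge and drops by at most log n for each object taken out of
   a class, and the number of edges grows by at most 2(a + b) <= 10a. The potential
     48 (n + 1) (11 (F(n) - sum_i F(|Si|)) + max(0, #edges - n))
   therefore pays for merges and rebuilds. *)

From mathcomp Require Import all_boot all_order all_algebra.
From mathcomp Require Import zify.
Require Import Defs.

Set Implicit Arguments.
Unset Strict Implicit.
Unset Printing Implicit Defensive.

Import Order.TTheory.

Local Open Scope comp_scope.
Local Notation log n := (trunc_log 2 n).

Lemma exists_minimizer (A : eqType) disp (D : orderType disp) (f : A -> D)
    (s : seq A) :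
  s != [::] -> exists2 x, x \in s & forall y, y \in s -> (f x <= f y)%O.
Proof.
elim: s => // a s IHs _; case: (eqVneq s [::]) => [->|/IHs[x xs xmin]].
  by exists a => [|y]; rewrite ?mem_head // inE => /eqP->.
case: (leP (f a) (f x)) => [ax|/ltW xa].
  exists a => [|y]; rewrite ?mem_head // inE => /predU1P[->//|/xmin].
  exact: le_trans.
exists x => [|y]; first by rewrite inE xs orbT.
by rewrite inE => /predU1P[->|/xmin].
Qed.

(** * Reasoning about computations *)

(* Quantifying over the weakenings of [P] makes the rule of consequence hold
   without a separate monotonicity proof for [m]. *)
Definition spec A (m : comp A) (P : A -> nat -> nat -> Prop) : Prop :=
  forall Q : A -> nat -> nat -> Prop, (forall a t w, P a t w -> Q a t w) -> m Q.

Section Spec.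

Variables A B : Type.
Implicit Types (P : B -> nat -> nat -> Prop) (k : A -> comp B).

Lemma spec_weaken (m : comp B) P1 P2 :
  spec m P1 -> (forall a t w, P1 a t w -> P2 a t w) -> spec m P2.
Proof. by move=> mP P12 Q P2Q; apply: mP => a t w /P12/P2Q. Qed.

Lemma spec_ret (b : B) P : P b 0 0 -> spec (ret b) P.
Proof. by move=> Pb Q; apply. Qed.

Lemma spec_bind (m : comp A) (P1 : A -> nat -> nat -> Prop) k P :
  spec m P1 ->
  (forall a t w, P1 a t w ->
     spec (k a) (fun b t' w' => P b (t + t') (maxn w w'))) ->
  spec (bind m k) P.
Proof.
move=> mP kP Q PQ; apply: mP => a t w /kP; apply=> b t' w'; exact: PQ.
Qed.

Lemma spec_choose_ret (C : B -> Prop) P :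
  (exists b, C b) -> (forall b, C b -> P b 0 0) -> spec (choose C) P.
Proof. by move=> Cne CP Q PQ; split=> // b /CP/PQ. Qed.

Lemma spec_tick n (m : comp B) P :
  spec m (fun b t w => P b (n + t) w) -> spec (tick n;; m) P.
Proof. by move=> mP Q PQ; apply: mP => b t w; rewrite max0n => /PQ. Qed.

Lemma spec_hold n (m : comp B) P :
  spec m (fun b t w => P b t (maxn n w)) -> spec (hold n;; m) P.
Proof. by move=> mP Q PQ; apply: mP => b t w /PQ. Qed.

Lemma spec_choose (C : A -> Prop) k P :
  (exists a, C a) -> (forall a, C a -> spec (k a) P) ->
  spec (bind (choose C) k) P.
Proof.
move=> Cne kP Q PQ; split=> // a /kP; apply=> b t w Pb.
by rewrite add0n max0n; exact: PQ.
Qed.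

Lemma spec_frame n (m : comp B) P :
  spec m (fun b t w => P b t (n + w)) -> spec (frame n m) P.
Proof. by move=> mP Q PQ; apply: mP => b t w /PQ. Qed.

End Spec.

(** The measure [size] supplies the number of iterations that [loop] asks for. The postcondition
    [P a] depends on the starting point, so one step only has to transfer a bound from [a'] to [a],
    adding its own time and taking the maximum of the memory peaks. *)
Lemma spec_loop A B (step : A -> comp (A + B)) (inv : A -> Prop) (size : A -> nat)
    (P : A -> B -> nat -> nat -> Prop) a :
  (forall a, inv a -> spec (step a) (fun r t w =>
     match r with
     | inl a' => [/\ inv a', size a' < size a
        & forall b t' w', P a' b t' w' -> P a b (t + t') (maxn w w')]
     | inr b => P a b t w
     end)) ->
  inv a -> spec (loop step a) (P a).
Proof.
move=> stepP inva Q PQ; exists (size a).+1; move: Q PQ.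
have H n a' : inv a' -> size a' < n -> spec (iterate n step a') (P a').
  elim: n a' => // n IHn a' inva' ltn /=.
  apply: (spec_bind (stepP a' inva')) => -[a2|b] t w.
    case=> inva2 lt2 imp; apply: (spec_weaken (P1 := P a2)); last exact: imp.
    by apply: IHn => //; exact: leq_trans lt2 ltn.
  by move=> Pb; apply: spec_ret; rewrite addn0 maxn0.
exact: H.
Qed.

Lemma spec_remove (T : eqType) B (x : T) s (k : seq T -> comp B) P :
  spec (k [seq y <- s | y != x]) (fun b t w => P b ((size s).+1 + t) w) ->
  spec (bind (remove x s) k) P.
Proof.
move=> kP; apply: (spec_bind (P1 := fun s' t w =>
  [/\ s' = [seq y <- s | y != x], t = (size s).+1 & w = 0])).
  by apply: spec_tick; apply: spec_ret; rewrite addn0.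
by move=> _ _ _ [-> -> ->]; apply: (spec_weaken kP) => b t w; rewrite max0n.
Qed.

Lemma size_filter_neq (T : eqType) (x : T) s :
  uniq s -> x \in s -> (size [seq y <- s | y != x]).+1 = size s.
Proof.
move=> us xs; rewrite -rem_filter // size_rem // prednK // -has_predT.
by apply/hasP; exists x.
Qed.

(** * Graphs *)

Section Graphs.

Context {T : eqType} {disp : Order.disp_t} {D : orderType disp}.
Variable d : T -> T -> D.
Hypothesis d_sym : forall s t, d s t = d t s.

Implicit Types (S Si : seq T) (G : seq (T * T)).

(** Only the source of the edge is tied to the pair. If the target is deleted, the source, hence [x]
    or [y], moves to a class with a new graph, and the pair is covered again. *)
Definition covered G x y : Prop :=
  exists2 e, e \in G & (e.1 \in [:: x; y]) && (d e.1 e.2 <= d x y)%O.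

Lemma sub_covered G G' x y :
  {subset G <= G'} -> covered G x y -> covered G' x y.
Proof. by move=> sGG' [e /sGG' eG' h]; exists e. Qed.

Lemma covered_sym G x y : covered G x y -> covered G y x.
Proof.
case=> e eG; rewrite !inE orbC d_sym => h.
by exists e; rewrite // !inE d_sym (d_sym y).
Qed.

Definition edges_in S G : Prop :=
  forall e, e \in G -> [/\ e.1 \in S, e.2 \in S & e.1 != e.2].

(** Of the path structure only in-degree at most one is retained, as distinctness of the targets. It
    survives the removal of edges, bounds the number of edges by the number of objects, and bounds
    the number of predecessors of a deleted object. *)
Definition graph_for S Si G : Prop :=
  [/\ uniq [seq e.2 | e <- G], edges_in S G, size G <= 2 * size Si
    & forall x y, x \in Si -> y \in S -> x != y -> covered G x y].

Lemma size_edges S G :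
  uniq [seq e.2 | e <- G] -> edges_in S G -> size G <= size S.
Proof.
move=> uG GS; rewrite -(size_map (fun e => e.2)).
by apply: uniq_leq_size => // _ /mapP[e /GS[_ ? _] ->].
Qed.

(* An edge leads from or to an object of [Si], and the path visits each of
   these once: this gives the bound on the number of edges. A pair that is not
   yet covered has both its members among the unvisited objects and the last
   vertex. *)
Definition walk_inv S Si (P : walk) : Prop :=
  let free := wfree P in let freei := wfreei P in
  let u := wlast P in let G := wedges P in
  [/\ [/\ uniq free, uniq freei, {subset free <= S}
        & freei =i [pred y | (y \in free) && (y \in Si)]],
      [/\ u \in S, u \notin free & size free < size S],
      uniq [seq e.2 | e <- G] /\ {in free, forall v, v \notin [seq e.2 | e <- G]},
      edges_in S G /\
      size G + 2 * size freei + (u \in Si) < 2 * size Si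
    & forall x y, x \in Si -> y \in S -> x != y ->
        covered G x y \/ (x \in u :: free) && (y \in u :: free)].

Lemma walk_inv_start S Si x :
  uniq S -> uniq Si -> {subset Si <= S} -> x \in Si ->
  walk_inv S Si
    (Walk x [seq y <- S | y != x] [seq y <- Si | y != x] [::]).
Proof.
move=> uS uSi sSiS xSi; have xS := sSiS _ xSi.
split=> //=.
- split; rewrite ?filter_uniq //.
    by move=> y; rewrite mem_filter => /andP[].
  move=> y; rewrite !inE !mem_filter; case: eqP => //= _.
  by apply/idP/andP => [ySi|[]//]; split=> //; exact: sSiS.
- by rewrite mem_filter eqxx size_filter_neq.
- by split=> //; rewrite xSi add0n; have := size_filter_neq uSi xSi; lia.
- move=> y z ySi zS _; right; rewrite !inE !mem_filter zS (sSiS _ ySi) !andbT.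
  by case: (y == x); case: (z == x).
Qed.

(** This quantity bounds the remaining steps. If [v] is in [Si], then [v] leaves [wfreei P], which
    saves 2 and costs at most 1. Otherwise [v] was found among all free objects, so the last vertex
    was in [Si] and the indicator drops from 1 to 0. *)
Lemma walk_progress S Si P v :
  let cand := if wlast P \in Si then wfree P else wfreei P in
  walk_inv S Si P -> v \in cand ->
  2 * size [seq y <- wfreei P | y != v] + (v \in Si)
    < 2 * size (wfreei P) + (wlast P \in Si).
Proof.
move=> /= [[ufree ufreei sfree freeiE] _ _ _ _] vc.
have [vSi|vSi] := boolP (v \in Si).
  have vfi : v \in wfreei P.
    by move: vc; case: ifP => // _ vf; rewrite freeiE inE vf.
  by have := size_filter_neq ufreei vfi; lia.
have -> : wlast P \in Si.
  by move: vc; case: ifP => // _; rewrite freeiE inE (negPf vSi) andbF.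
have : size [seq y <- wfreei P | y != v] <= size (wfreei P).
  by rewrite size_filter count_size.
lia.
Qed.

Lemma walk_inv_step S Si P v :
  let cand := if wlast P \in Si then wfree P else wfreei P in
  walk_inv S Si P -> v \in cand ->
  (forall w, w \in cand -> (d (wlast P) v <= d (wlast P) w)%O) ->
  walk_inv S Si (Walk v [seq y <- wfree P | y != v]
    [seq y <- wfreei P | y != v] ((wlast P, v) :: wedges P)).
Proof.
case: P => u free freei G /= Pinv.
case: (Pinv) => /= -[ufree ufreei sfree freeiE] [uS ufr szf] [uG Gfree] [GS szG] cov.
move=> vc vmin.
have vfree : v \in free.
  by move: vc; case: ifP => // _; rewrite freeiE => /andP[].
have vS := sfree _ vfree.
have uv : u != v by apply: contraNneq ufr => ->.
split=> /=.
- split; rewrite ?filter_uniq //.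
    by move=> y; rewrite mem_filter => /andP[_ /sfree].
  by move=> y; rewrite !inE !mem_filter freeiE !inE andbA.
- split; rewrite ?mem_filter ?eqxx //.
  by apply: leq_trans szf; rewrite ltnS size_filter count_size.
- rewrite uG Gfree //; split=> // y; rewrite mem_filter inE => /andP[yv yf].
  by rewrite negb_or yv Gfree.
- split=> [e|]; first by rewrite inE => /predU1P[->|/GS].
  by have := walk_progress Pinv vc; move: szG => /=; clear; lia.
- move=> x y xSi yS xy.
  case: (cov x y xSi yS xy) => [[e eG h]|].
    by left; exists e => //; rewrite inE eG orbT.
  have new z : d u z = d x y -> z \in (if u \in Si then free else freei) ->
      u \in [:: x; y] -> covered ((u, v) :: G) x y.
    move=> dz /vmin; rewrite dz => le_vz uxy.
    by exists (u, v); rewrite ?mem_head //= uxy.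
  (* If [x] is the last vertex, it lies in [Si], so every free object, [y] included, was a
     candidate. If [y] is the last vertex, [x] is free and in [Si], hence a candidate either way. If
     neither is, both are free or equal to the new last vertex. *)
  case/andP; rewrite !inE => /predU1P[xu|xf] /predU1P[yu|yf].
  + by rewrite xu yu eqxx in xy.
  + by left; apply: (new y); rewrite ?mem_head -xu ?xSi // mem_head.
  + left; apply: (new x); rewrite ?yu ?inE ?eqxx ?orbT //.
    by case: ifP => // _; rewrite freeiE inE xf xSi.
  + by right; rewrite !mem_filter xf yf !andbT; case: eqP; case: eqP.
Qed.

(** An iteration makes at most four traversals of lists of at most n objects, hence the factor 4 (n
    + 1). The measure of [walk_progress] counts the extensions, and the final [.+1] is the iteration
    that finds no candidate. *)
Lemma spec_extend_loop S Si P :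
  uniq S -> {subset Si <= S} -> uniq Si -> walk_inv S Si P ->
  spec (loop (extend d Si) P) (fun G t w =>
    [/\ graph_for S Si G,
        t <= 4 * (size S).+1 * (2 * size (wfreei P) + (wlast P \in Si)).+1
      & w <= (4 * size S).+1]).
Proof.
move=> uS sSiS uSi.
have leSi : size Si <= size S by exact: uniq_leq_size.
apply: (spec_loop (size := fun P => size (wfree P))
  (P := fun P G t w => [/\ graph_for S Si G,
        t <= 4 * (size S).+1 * (2 * size (wfreei P) + (wlast P \in Si)).+1
      & w <= (4 * size S).+1])) => {}P Pinv.
case: P Pinv => u free freei G Pinv.
have [] := Pinv => /= -[ufree ufreei sfree freeiE] [uSS ufr szf] [uG Gfree].
move=> [GS szG] cov.
have lefi : size freei <= size Si.
  by apply: uniq_leq_size => // y; rewrite freeiE inE => /andP[].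
have leG := size_edges uG GS.
apply: spec_hold; rewrite /scan /=; apply: spec_tick.
have step := walk_inv_step (v := _) Pinv.
case cE : (if u \in Si then free else freei) => [|c cs].
  apply: spec_ret; split; first last.
  - by rewrite maxn0; move: leSi szf lefi leG; clear; lia.
  - by move: leSi; clear; lia.
  split=> //; first by move: szG; clear; lia.
  (* An uncovered pair cannot remain. If the last vertex is in [Si], no object is free and both
     members would equal that vertex. Otherwise [x], being in [Si], is neither free nor the last
     vertex. *)
  move=> x y xSi yS xy; case: (cov x y xSi yS xy) => // /andP[].
  rewrite !inE; case: ifP cE => uSi' cE.
    by rewrite cE !in_nil !orbF => /eqP xu /eqP yu; rewrite xu yu eqxx in xy.
  have xNf : x \notin free.
    by have := freeiE x; rewrite cE inE xSi andbT in_nil => <-.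
  by rewrite (negPf xNf) orbF => /eqP xu; rewrite -xu xSi in uSi'.
have szc : size (c :: cs) <= size S.
  by rewrite -cE; case: ifP => _; [exact: ltnW | exact: leq_trans leSi].
rewrite -cE in szc *; move: szc; set cand := (X in size X) => szc.
apply: (spec_bind (P1 := fun v t w => [/\ v \in cand,
   forall w, w \in cand -> (d u v <= d u w)%O, t <= (size S).+1 & w = 0])).
  apply: spec_tick; have cand0 : cand != [::] by rewrite /cand cE.
  have [v vc vmin] := exists_minimizer (d u) cand0.
  by apply: spec_choose_ret => [|w [wc wmin]]; [exists v|rewrite addn0].
move=> v t w [vc vmin let_ ->].
apply: spec_remove; apply: spec_remove; apply: spec_ret.
split; first exact: step.
  rewrite /= -[X in _ < X](size_filter_neq ufree (x := v)) //.
  by move: vc; rewrite /cand; case: ifP => // _; rewrite freeiE inE => /andP[].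
move=> G' t' w' [G'ok let' lew']; split=> //; last first.
  by move: leSi szf lefi leG lew'; clear; lia.
have := walk_progress Pinv vc; move: let' => /=.
set m := _ + (v \in Si); set m' := _ + (u \in Si) => let' lt_m.
have : 4 * (size S).+1 * m.+2 <= 4 * (size S).+1 * m'.+1.
  by rewrite leq_mul2l ltnS lt_m orbT.
by move: let' let_ szf lefi leSi; clear; lia.
Qed.

(** The walk starts in [Si] with |Si| - 1 of its objects unvisited, so it takes at most 2 |Si|
    iterations of cost 4 (n + 1). The extra 8 (n + 1) pays for the setup, and for an empty [Si]. *)
Lemma spec_new_graph S Si :
  uniq S -> uniq Si -> {subset Si <= S} ->
  spec (new_graph d S Si) (fun G t w =>
    [/\ graph_for S Si G, t <= 8 * (size S).+1 * (size Si).+1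
      & w <= (4 * size S).+1]).
Proof.
move=> uS uSi sSiS; apply: spec_tick.
have leSi : size Si <= size S by exact: uniq_leq_size.
case: (eqVneq Si [::]) => [->|Si0].
  by apply: spec_ret; split=> //; lia.
have -> (X Y : comp (seq (T * T))) : (if Si is [::] then X else Y) = Y.
  by case: (Si) Si0.
apply: spec_choose.
  by case: (Si) Si0 => // x s _; exists x; rewrite mem_head.
move=> x xSi; apply: spec_remove; apply: spec_remove.
have := spec_extend_loop uS sSiS uSi (walk_inv_start uS uSi sSiS xSi).
move=> /spec_weaken; apply=> G t w [Gok le_t le_w]; split=> //.
have := size_filter_neq uSi xSi; move: le_t => /=; rewrite xSi.
set n := size [seq _ <- _ | _] => let_ eq_n; rewrite -eq_n in leSi *.
nia.
Qed.

End Graphs.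

(** * The potential function *)

(** A substitute for n log n, summing the rounded-down logarithms of 1, ..., n: its increments are
    exactly logarithms, so adding or removing one object is easy to account for. *)
Definition sum_log n := \sum_(j < n) log j.+1.

Lemma sum_logS n : sum_log n.+1 = sum_log n + log n.+1.
Proof. exact: big_ord_recr. Qed.

Lemma sum_log0 : sum_log 0 = 0.
Proof. exact: big_ord0. Qed.

Lemma leq_sum_log_sub m n k : m <= n -> n <= k ->
  sum_log n <= sum_log m + (n - m) * log k.
Proof.
elim: n => [|n IHn]; first by rewrite sum_log0.
rewrite leq_eqVlt => /predU1P[->|]; first by rewrite leq_addr.
rewrite ltnS => mn nk; rewrite sum_logS subSn // mulSn.
have := IHn mn (ltnW nk); have := leq_trunc_log 2 nk; lia.
Qed.

Lemma sum_log_le n : sum_log n <= n * log n.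
Proof. by have := leq_sum_log_sub (leq0n n) (leqnn n); rewrite sum_log0 subn0. Qed.

(** Induction on the smaller size: the term gained on the right is log (a + b + 1), and since a + 1
    <= b it is at least log (2 (a + 1)), one more than the term gained on the left. So each object
    of the smaller set earns one unit. *)
Lemma sum_logD_strong a b : a <= b -> sum_log a + sum_log b + a <= sum_log (a + b).
Proof.
elim: a => [|a IHa] lab; first by rewrite sum_log0 !add0n addn0.
rewrite addSn !sum_logS.
have : log (2 * a.+1) <= log (a + b).+1 by apply: leq_trunc_log; lia.
rewrite trunc_logMp //; have := IHa (ltnW lab); lia.
Qed.

Lemma sum_logD a b : sum_log a + sum_log b <= sum_log (a + b).
Proof.
wlog lab : a b / a <= b => [H|].
  by case: (leqP a b) => [/H//|/ltnW/H]; rewrite addnC (addnC b).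
exact: leq_trans (leq_addr _ _) (sum_logD_strong lab).
Qed.

Lemma trunc_logS_le n : log n.+1 <= (log n).+1.
Proof.
case: n => [|n]; first by rewrite trunc_log1.
rewrite -trunc_logMp //; apply: leq_trunc_log; lia.
Qed.

(** * Partitions into classes *)

(* Otherwise the sizes grow by a factor of more than 4 each time. *)
Lemma close_neighbours (A : Type) (f : A -> nat) x s :
  path (fun p q => f p <= f q) x s ->
  (exists l p q r,
     [/\ x :: s = l ++ [:: p, q & r], f p <= f q & f q <= 4 * f p])
  \/ 4 ^ size s * f x <= f (last x s).
Proof.
elim: s x => [|y s IHs] x /=; first by right; rewrite mul1n.
case/andP=> xy /IHs[[l [p [q [r [E pq qp]]]]]|IH].
  by left; exists (x :: l), p, q, r; rewrite E.
case: (leqP (f y) (4 * f x)) => [yx|/ltnW xy4].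
  by left; exists [::], x, y, s.
right; apply: leq_trans IH; rewrite expnSr -mulnA.
by rewrite leq_mul2l xy4 orbT.
Qed.

Section Parts.

Context {T : eqType} {disp : Order.disp_t} {D : orderType disp}.
Variable d : T -> T -> D.
Hypothesis d_sym : forall s t, d s t = d t s.

Implicit Types (S : seq T) (p q : part (T := T)) (ps : seq (part (T := T))).

Definition classes ps : seq T := flatten [seq p.1 | p <- ps].

(** Coverage is demanded from the two graphs of the classes concerned, not from all graphs together,
    so that it persists when other classes and their graphs are discarded. The case [p = q] handles
    pairs within one class. *)
Definition graphs_inv S ps : Prop :=
  (forall p, p \in ps -> uniq [seq e.2 | e <- p.2] /\ edges_in S p.2) /\
  (forall p q, p \in ps -> q \in ps -> forall x y,
     x \in p.1 -> y \in q.1 -> x != y -> covered d (p.2 ++ q.2) x y).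

Definition parts_inv S ps : Prop :=
  [/\ uniq S, perm_eq (classes ps) S & graphs_inv S ps].

Definition proper ps : bool := all (fun p => p.1 != [::]) ps.

Definition weight ps := \sum_(p <- ps) sum_log (size p.1).

(** Subtraction is truncated. The first difference is genuine when the classes have n objects in
    all, by [weight_le]; the second acts as a maximum with zero, so fewer than n edges earn no
    credit. *)
Definition potential n ps :=
  48 * n.+1 * (11 * (sum_log n - weight ps) + (size (all_edges ps) - n)).

Lemma size_all_edges ps : size (all_edges ps) = \sum_(p <- ps) size p.2.
Proof. by rewrite size_flatten sumnE /shape -map_comp big_map. Qed.

Lemma size_classes ps : size (classes ps) = \sum_(p <- ps) size p.1.
Proof. by rewrite size_flatten sumnE /shape -map_comp big_map. Qed.

Lemma sum_part_succ (f : part (T := T) -> nat) ps :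
  \sum_(p <- ps) (f p).+1 = \sum_(p <- ps) f p + size ps.
Proof.
under eq_bigr do rewrite -addn1.
by rewrite big_split /= sum1_size.
Qed.

Lemma wordsE S ps : words S ps =
  (size S + (size (classes ps) + size (all_edges ps) + size ps)).+1.
Proof.
by rewrite /words sum_part_succ big_split /= size_all_edges size_classes.
Qed.

Lemma mem_classes p x ps : p \in ps -> x \in p.1 -> x \in classes ps.
Proof. by move=> pps xp; apply/flattenP; exists p.1 => //; apply: map_f. Qed.

Lemma mem_all_edges p e ps : p \in ps -> e \in p.2 -> e \in all_edges ps.
Proof. by move=> pps ep; apply/flattenP; exists p.2 => //; apply: map_f. Qed.

Lemma size_proper ps : proper ps -> size ps <= size (classes ps).
Proof.
rewrite size_classes -sum1_size => /allP ps0.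
rewrite big_seq [leqRHS]big_seq; apply: leq_sum => p /ps0.
by case: (p.1).
Qed.

Lemma weight_le ps : weight ps <= sum_log (size (classes ps)).
Proof.
rewrite size_classes /weight; elim: ps => [|p ps IHps]; first by rewrite !big_nil.
rewrite !big_cons; apply: leq_trans (sum_logD _ _).
by rewrite leq_add2l.
Qed.

Lemma weight_nonempty ps : weight (nonempty ps) = weight ps.
Proof.
rewrite /weight big_filter [RHS](bigID (fun p => p.1 != [::])) /=.
rewrite [X in _ = _ + X]big1 ?addn0 // => p /negPn/eqP->; exact: sum_log0.
Qed.

Lemma classes_nonempty ps : classes (nonempty ps) = classes ps.
Proof.
rewrite /classes; elim: ps => //= p ps IHps.
by case: eqP => /= [->|_]; rewrite IHps.
Qed.

Lemma proper_nonempty ps : proper (nonempty ps).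
Proof. exact: filter_all. Qed.

Lemma size_edges_nonempty ps :
  size (all_edges (nonempty ps)) <= size (all_edges ps).
Proof.
rewrite !size_all_edges big_filter big_mkcond leq_sum // => p _.
by case: ifP.
Qed.

Lemma sub_parts_inv S ps ps' :
  uniq S -> perm_eq (classes ps') S -> {subset ps' <= ps} -> graphs_inv S ps ->
  parts_inv S ps'.
Proof.
move=> uS cS sub [gr cov]; split=> //; split=> [p /sub/gr//|p q /sub pps /sub qps].
exact: cov.
Qed.

Lemma parts_inv_nonempty S ps : parts_inv S ps -> parts_inv S (nonempty ps).
Proof.
case=> uS cS; apply: sub_parts_inv; rewrite ?classes_nonempty // => p.
by rewrite mem_filter => /andP[].
Qed.

(** A graph built for [Y] against all of [S] covers every pair with a member in [Y], on either side
    by symmetry of [d]. Only pairs among the older classes rely on the older graphs. *)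
Lemma parts_inv_cons S Y G ps :
  uniq S -> graph_for d S Y G -> perm_eq (Y ++ classes ps) S ->
  graphs_inv S ps -> parts_inv S ((Y, G) :: ps).
Proof.
move=> uS [uG GS szG covG] YS [gr cov]; split=> //; split=> [p|p q].
  by rewrite inE => /predU1P[->|/gr].
have sub r z : r \in (Y, G) :: ps -> z \in r.1 -> z \in S.
  by move=> rps zr; rewrite -(perm_mem YS); apply: (mem_classes rps).
move=> pps qps x y xp yq xy; move: (sub _ _ pps xp) (sub _ _ qps yq) => xS yS.
move: pps; rewrite inE => /predU1P[pE|pps].
  move: xp; rewrite pE => /covG/(_ yS xy); apply: sub_covered => e /= eG.
  by rewrite mem_cat eG.
move: qps; rewrite inE => /predU1P[qE|qps]; last exact: cov xy.
rewrite eq_sym in xy; move: yq; rewrite qE => /covG/(_ xS xy)/(covered_sym d_sym).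
by apply: sub_covered => e /= eG; rewrite mem_cat eG orbT.
Qed.

Lemma size_parts S ps :
  parts_inv S ps -> \sum_(p <- ps) size p.1 = size S.
Proof. by case=> _ /perm_size <- _; rewrite size_classes. Qed.

Lemma weight_le_size S ps : parts_inv S ps -> weight ps <= sum_log (size S).
Proof. by case=> _ /perm_size <- _; exact: weight_le. Qed.

(** * Merging *)

Lemma balanced_pair ps :
  proper ps -> log (size (classes ps)) < size ps -> 1 < size ps ->
  exists p q ps', [/\ perm_eq ps [:: p, q & ps'], size p.1 <= size q.1
    & size q.1 <= 4 * size p.1].
Proof.
move=> prop lt_log lt1; pose r := fun p q => size p.1 <= size q.1.
have rtot : total r by move=> p q; exact: leq_total.
have srt := sort_sorted rtot ps.
have pss : perm_eq (sort r ps) ps by rewrite perm_sort.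
case E : (sort r ps) pss srt => [|x s] pss /= srt.
  by move: lt1; rewrite -(perm_size pss).
have [[l [p [q [t [E' pq qp]]]]]|] :=
  close_neighbours (f := fun p : part => size p.1) srt.
  exists p, q, (l ++ t); split=> //.
  rewrite perm_sym (perm_trans _ pss) // E'.
  exact: permEl (perm_catCA [:: p; q] l t).
set z := last x s => le4.
have xps : x \in ps by rewrite -(perm_mem pss) mem_head.
have zps : z \in ps by rewrite -(perm_mem pss) mem_last.
have x0 : 0 < size x.1 by move/allP: prop => /(_ x xps); case: (x.1).
have szz : size z.1 <= size (classes ps).
  by rewrite size_classes (big_rem z zps) leq_addr.
have szs : (size s).+1 = size ps by rewrite -(perm_size pss).
rewrite -szs !ltnS in lt_log lt1.
(* Here [size s] is at least log n and at least 1, so 2 * [size s] is at least log n + 1, and the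
   largest class would have more than n objects. *)
have := trunc_log_ltn (size (classes ps)) (isT : 1 < 2).
rewrite ltnNge => /negP[]; apply: leq_trans szz; apply: leq_trans le4.
apply: leq_trans (leq_pmulr _ x0); rewrite -[4]/(2 ^ 2) -expnM leq_exp2l //.
by move: lt_log lt1; clear; lia.
Qed.

(** Since a merge minimizes the ratio, one pair of ratio at most 4 forces the chosen pair to have
    ratio at most 4. *)
Lemma ratio_le4 p q p1 q1 :
  0 < size p.1 -> 0 < size p1.1 -> (ratio p q <= ratio p1 q1)%R ->
  size q1.1 <= 4 * size p1.1 -> size q.1 <= 4 * size p.1.
Proof.
move=> p0 p10 le_r le4; have := le_trans le_r (_ : ratio p1 q1 <= 4%:R)%R.
rewrite /ratio !Num.Theory.ler_pdivrMr ?Num.Theory.ltr0n //.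
rewrite -!GRing.natrM !Num.Theory.ler_nat.
exact.
Qed.

(** [choose] gets stuck without a witness, so a best pair must exist. The quantification over
    rearrangements of [ps] reduces to a finite list of pairs, where [rem p ps] prevents a class from
    being paired with itself. *)
Lemma exists_best_pair ps :
  1 < size ps ->
  exists pqs : part (T := T) * part (T := T) * seq (part (T := T)),
    let '(p, q, ps') := pqs in
    [/\ perm_eq ps [:: p, q & ps'], size p.1 <= size q.1
      & forall p1 q1 ps1, perm_eq ps [:: p1, q1 & ps1] ->
          size p1.1 <= size q1.1 -> (ratio p q <= ratio p1 q1)%R].
Proof.
move=> lt1; pose cands := [seq pq <- [seq (p, q) | p <- ps, q <- rem p ps]
  | size pq.1.1 <= size pq.2.1].
have candsP p q ps1 : perm_eq ps [:: p, q & ps1] -> size p.1 <= size q.1 ->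
    (p, q) \in cands.
  move=> E le_pq; rewrite mem_filter le_pq; apply/allpairsPdep; exists p, q.
  have pps : p \in ps by rewrite (perm_mem E) mem_head.
  split=> //; move: E; rewrite (permPl (perm_to_rem pps)) perm_cons => /perm_mem->.
  exact: mem_head.
have cands0 : cands != [::].
  apply/eqP => c0; move: candsP; rewrite {}c0.
  case: (ps) lt1 => [|a [|b s]] // _ candsP.
  case/orP: (leq_total (size a.1) (size b.1)) => [/(candsP a b s)|/(candsP b a s)].
    by move=> /(_ (perm_refl _)).
  by rewrite (permEl (perm_catCA [:: a] [:: b] s)) => /(_ isT).
have [[p q]] := exists_minimizer (fun pq => ratio pq.1 pq.2) cands0.
rewrite mem_filter => /andP[/= le_pq /allpairsPdep[p' [q' [pps qps [ep eq]]]]] min_pq.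
subst p' q'.
exists (p, q, rem q (rem p ps)); split=> //.
  by rewrite (permPl (perm_to_rem pps)) perm_cons perm_to_rem.
by move=> p1 q1 ps1 E /(candsP _ _ _ E)/min_pq.
Qed.

Lemma parts_inv_merge S ps p q ps' G :
  parts_inv S ps -> perm_eq ps [:: p, q & ps'] ->
  graph_for d S (p.1 ++ q.1) G -> parts_inv S ((p.1 ++ q.1, G) :: ps').
Proof.
case=> uS cS [gr cov] E Gok.
have sub : {subset ps' <= ps}.
  by move=> r rps; rewrite (perm_mem E) !inE rps !orbT.
apply: parts_inv_cons => //; last first.
  by split=> [r /sub/gr//|r1 r2 /sub r1ps /sub r2ps]; exact: cov.
rewrite -catA; apply: perm_trans cS; rewrite perm_sym.
exact: perm_flatten (perm_map _ E).
Qed.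

(** The weight grows by at least a and the number of edges by at most 2 (a + b) <= 10 a, so the
    bracket drops by at least 11 a - 10 a = a. The bound on the new weight ensures that truncation
    does not swallow this gain. *)
Lemma potential_merge n a b ps p q ps' G :
  perm_eq ps [:: p, q & ps'] -> size p.1 = a -> size q.1 = b ->
  a <= b -> b <= 4 * a -> size G <= 2 * (a + b) -> 
  weight ((p.1 ++ q.1, G) :: ps') <= sum_log n ->
  48 * n.+1 * a + potential n ((p.1 ++ q.1, G) :: ps') <= potential n ps.
Proof.
move=> E pa qb ab b4 szG; rewrite /potential !size_all_edges /weight.
rewrite !(perm_big _ E) /= !big_cons /= size_cat pa qb => lt_w.
have := sum_logD_strong ab; move: lt_w; set w := bigop _ _ _.
set e := bigop _ _ _ => lt_w le_s.
rewrite -mulnDr leq_mul2l; apply/orP; right.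
move: lt_w le_s szG ab b4; clear; lia.
Qed.

End Parts.

(** * Amortized cost of merging *)

Section Operations.

Context {T : eqType} {disp : Order.disp_t} {D : orderType disp}.
Variable d : T -> T -> D.
Hypothesis d_sym : forall s t, d s t = d t s.

Implicit Types (S : seq T) (ps : seq (part (T := T))) (st : state (T := T)).

Lemma spec_framed_new_graph B m S Si (k : _ -> comp B) P :
  uniq S -> uniq Si -> {subset Si <= S} ->
  (forall G t w, graph_for d S Si G -> t <= 8 * (size S).+1 * (size Si).+1 ->
     w <= m + (4 * size S).+1 ->
     spec (k G) (fun b t' w' => P b (t + t') (maxn w w'))) ->
  spec (bind (frame m (new_graph d S Si)) k) P.
Proof.
move=> uS uSi sSiS kP; apply: (spec_bind (P1 := fun G t w =>
  [/\ graph_for d S Si G, t <= 8 * (size S).+1 * (size Si).+1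
    & w <= m + (4 * size S).+1])).
  apply: spec_frame; apply: spec_weaken (spec_new_graph d_sym uS uSi sSiS) _.
  by move=> G t w [? ? ?]; rewrite leq_add2l; split.
by move=> G t w [? ? ?]; exact: kP.
Qed.

Definition max_parts n := maxn (log n) 1.

(** The cost of one round of merging apart from the new graph. The dominant part is the comparison
    of all pairs of k classes: k is at most n and at most log n + 3, so k ^ 2 is at most n (log n +
    3). *)
Definition step_cost n := n.+1 * (log n + 8).

(** The excess of [size ps] over [max_parts] counts the merges. Each adds at most n edges and costs
    [step_cost] beyond the potential it releases; the extra [.+1] is the final test. The allowance
    of two classes is for deletions, which add a class and may lower [max_parts] by one. *)
Lemma spec_merge S ps :
  parts_inv d S ps -> proper ps -> size ps <= max_parts (size S) + 2 ->
  spec (merge d S ps) (fun ps' t w =>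
    let n := size S in
    [/\ parts_inv d S ps', proper ps' /\ size ps' <= max_parts n,
        size (all_edges ps')
          <= size (all_edges ps) + n * (size ps - max_parts n),
        t + potential n ps'
          <= potential n ps + step_cost n * (size ps - max_parts n).+1
      & w <= 7 * n.+1 + size ps
             + (size (all_edges ps) + n * (size ps - max_parts n))]).
Proof.
move=> psinv psprop psz; rewrite /merge.
apply: (spec_loop (size := size)
  (inv := fun ps => [/\ parts_inv d S ps, proper ps
     & size ps <= max_parts (size S) + 2])
  (P := fun ps ps' t w =>
    [/\ parts_inv d S ps', proper ps' /\ size ps' <= max_parts (size S),
        size (all_edges ps') <= size (all_edges ps)
          + size S * (size ps - max_parts (size S)),
        t + potential (size S) ps' <= potential (size S) ps
          + step_cost (size S) * (size ps - max_parts (size S)).+1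
      & w <= 7 * (size S).+1 + size ps + (size (all_edges ps)
          + size S * (size ps - max_parts (size S)))]) _ _); last by split.
move=> {psinv psprop psz}ps [psinv psprop psz].
have [uS cS _] := psinv; have szc := perm_size cS.
have k_le : size ps <= size S by rewrite -szc; exact: size_proper.
have k2_le : size ps ^ 2 <= size S * (log (size S) + 3).
  rewrite expnS expn1 leq_mul //; apply: leq_trans psz _.
  by rewrite /max_parts; clear; lia.
have cost_le : (size S).+1 + (size ps).+1 + (size S + size ps) + size ps ^ 2
    + (size S).+1 <= step_cost (size S).
  by move: k_le k2_le; rewrite /step_cost; clear; nia.
apply: spec_hold; apply: spec_tick; apply: spec_tick.
have wE := wordsE S ps; rewrite szc in wE.
case: ifP => [stop|/negbFE/andP[lt_log lt1]].
  apply: spec_ret; split=> //.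
  - split=> //; move: stop; rewrite negb_and -!leqNgt /max_parts; clear; lia.
  - exact: leq_addr.
  - by move: cost_le; clear; nia.
  - by rewrite wE; clear; lia.
apply: spec_tick; apply: spec_tick; rewrite sum_part_succ (size_parts psinv).
apply: spec_choose; first exact: exists_best_pair.
move=> [[p q] ps'] [E le_pq best]; apply: spec_tick.
have [p1 [q1 [ps1 [E1 le1 le4]]]] : exists p q ps',
    [/\ perm_eq ps [:: p, q & ps'], size p.1 <= size q.1
      & size q.1 <= 4 * size p.1].
  by apply: balanced_pair; rewrite ?szc.
have pos r : r \in ps -> 0 < size r.1.
  by move/allP: psprop => h /h; case: (r.1).
have p0 : 0 < size p.1 by apply: pos; rewrite (perm_mem E) mem_head.
have qp4 : size q.1 <= 4 * size p.1.
  apply: ratio_le4 p0 _ (best _ _ _ E1 le1) le4.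
  by apply: pos; rewrite (perm_mem E1) mem_head.
have cE : perm_eq ((p.1 ++ q.1) ++ classes ps') S.
  rewrite -catA; apply: perm_trans cS; rewrite perm_sym.
  exact: perm_flatten (perm_map _ E).
have upq : uniq (p.1 ++ q.1).
  by move: uS; rewrite -(perm_uniq cE) cat_uniq => /andP[].
have spq : {subset p.1 ++ q.1 <= S}.
  by move=> x xpq; rewrite -(perm_mem cE) mem_cat xpq.
have szpq : size (p.1 ++ q.1) <= size S by exact: uniq_leq_size.
apply: spec_framed_new_graph => // G t w Gok le_t le_w; apply: spec_ret.
have [uG GS szG _] := Gok; have szGS := size_edges uG GS.
have inv' := parts_inv_merge d_sym psinv E Gok.
have szps : size ps = (size ps').+2 by rewrite (perm_size E).
have lt_max : max_parts (size S) < size ps.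
  by rewrite gtn_max lt_log lt1.
have E'_le : size (all_edges ((p.1 ++ q.1, G) :: ps'))
    <= size S + size (all_edges ps).
  rewrite !size_all_edges (perm_big _ E) !big_cons /=.
  by set e := bigop _ _ _; move: szGS; clear; lia.
have pot_le : 48 * (size S).+1 * size p.1
    + potential (size S) ((p.1 ++ q.1, G) :: ps') <= potential (size S) ps.
  apply: potential_merge E _ _ le_pq qp4 _ _ => //.
    by rewrite -size_cat.
  exact: weight_le_size inv'.
(* With 1 <= a and b <= 4 a, the size a + b + 1 is at most 6 a, and 48 = 8 * 6. *)
have t_le : t <= 48 * (size S).+1 * size p.1.
  apply: leq_trans le_t _; rewrite -[48]/(8 * 6) -!mulnA leq_mul2l /= mulnCA.
  rewrite leq_mul2l size_cat; apply/orP; right.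
  by move: p0 qp4; move: (size p.1) (size q.1); clear; lia.
set ps2 := _ :: ps' in inv' E'_le pot_le *.
have sz2 : size ps = (size ps2).+1 by [].
split.
- split=> //.
    rewrite /ps2 /proper /= -size_eq0 size_cat.
    apply/andP; split; first by rewrite -lt0n addn_gt0 p0.
    move: psprop; rewrite /proper (perm_all _ E) /=.
    by case/and3P.
  by apply: leq_trans psz; rewrite szps.
- by rewrite szps.
move=> ps3 t' w' [inv3 prop3 E3 t3 w3].
set m := max_parts (size S) in lt_max E3 t3 w3 *.
have km : size ps - m = (size ps2 - m).+1.
  by move: lt_max; rewrite sz2; move: (size ps2); clear; lia.
rewrite {}km; move: E3 t3 w3; set j := size ps2 - m => E3 t3 w3.
split=> //.
- move: E3 E'_le; rewrite mulnS; move: (size (all_edges _)) => e.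
  by move: (size (all_edges _)) (size (all_edges _)) => e1 e2; clear; lia.
- rewrite [_ * j.+2]mulnS; move: szpq t3 pot_le t_le cost_le; clear.
  set c := step_cost _ * _; lia.
- rewrite wE mulnS; move: w3 E'_le le_w; rewrite wE sz2.
  move: (size ps2) (size (all_edges ps)) (size (all_edges ps2)); clear; lia.
Qed.

(** * Rebuilding, reporting and the end of an update *)

Lemma spec_single_part S :
  uniq S ->
  spec (single_part d S) (fun ps t w => let n := size S in
    [/\ parts_inv d S ps, proper ps /\ size ps <= 1,
        size (all_edges ps) <= n /\ potential n ps = 0,
        t <= n.+1 + 8 * n.+1 * n.+1 & w <= 6 * n + 3]).
Proof.
move=> uS; apply: spec_tick; apply: spec_framed_new_graph => // G t w Gok le_t le_w.
have [uG GS _ _] := Gok; have szG := size_edges uG GS.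
apply: spec_ret; split.
- apply: parts_inv_nonempty; apply: parts_inv_cons => //.
  by rewrite cats0.
- split; first exact: proper_nonempty.
  by rewrite size_filter; exact: (count_size _ [:: (S, G)]).
- have szE : size (all_edges (nonempty [:: (S, G)])) <= size S.
    apply: leq_trans (size_edges_nonempty _) _.
    by rewrite /all_edges /= cats0.
  (* A single class of n objects has weight [sum_log n], and there are at most n edges, so both
     truncated differences vanish. *)
  split=> //; rewrite /potential weight_nonempty /weight big_seq1 /= subnn.
  by move: szE; rewrite -subn_eq0 => /eqP->; rewrite !muln0.
- by rewrite addn0 leq_add2l.
- move: le_w; rewrite wordsE /classes /all_edges /= cats0.
  by clear; lia.
Qed.

Lemma covered_all_edges S ps x y :
  parts_inv d S ps -> x \in S -> y \in S -> x != y ->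
  covered d (all_edges ps) x y.
Proof.
case=> _ cS [_ cov]; rewrite -!(perm_mem cS).
move=> /flattenP[_ /mapP[p pps ->] xp] /flattenP[_ /mapP[q qps ->] yq] xy.
apply: sub_covered (cov _ _ pps qps _ _ xp yq xy) => e.
by rewrite mem_cat => /orP[]; exact: mem_all_edges.
Qed.

Lemma all_edges_in S ps : parts_inv d S ps -> edges_in S (all_edges ps).
Proof.
case=> _ _ [gr _] e /flattenP[_ /mapP[p pps ->] ep].
by have [_] := gr p pps; exact.
Qed.

Lemma spec_report S ps :
  parts_inv d S ps ->
  spec (report d S ps) (fun st t w =>
    [/\ objects st = S, parts st = ps, is_closest_pair d S (closest st),
        t = size ps + size (all_edges ps) + 2 & w = words S ps]).
Proof.
move=> psinv; rewrite /report; apply: spec_hold; apply: spec_tick; apply: spec_tick.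
have tE b : (size ps).+1 + ((size (all_edges ps)).+1 + b) =
    size ps + size (all_edges ps) + 2 + b.
  by move: (size ps) (size _); clear; lia.
have [E0|E0] := eqVneq (all_edges ps) [::].
  move: (tE 0); rewrite E0 => {}tE; apply: spec_ret; split=> //.
  - rewrite /= leqNgt; apply/negP => lt1.
    have [uS _ _] := psinv.
    case: S lt1 uS psinv => [|x [|y S]] // _ /= /andP[]; rewrite inE negb_or.
    case/andP=> xy _ _ psinv.
    have [] // := covered_all_edges psinv (_ : x \in _) (_ : y \in _) xy.
    + by rewrite mem_head.
    + by rewrite !inE eqxx orbT.
    + by rewrite E0.
  - by rewrite tE addn0.
case E : (all_edges ps) (E0) => [//|e0 es] _; rewrite -E.
apply: spec_choose.
  by have [e eE emin] := exists_minimizer (fun e => d e.1 e.2) E0; exists e.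
move=> [s t] [eE emin]; apply: spec_ret; split=> //.
- have [e1 e2 e12] := all_edges_in psinv eE.
  (* Some edge is at most as long as the pair [x], [y], and the reported edge is at most as long as
     that edge. *)
  split=> // x y xS yS xy.
  have [e' e'E /andP[_]] := covered_all_edges psinv xS yS xy.
  by apply: le_trans; exact: emin e' e'E.
- by rewrite tE addn0.
Qed.

Definition state_inv st : Prop :=
  let S := objects st in let ps := parts st in
  [/\ parts_inv d S ps, proper ps, size ps <= max_parts (size S),
      size (all_edges ps) <= 2 * size S & is_closest_pair d S (closest st)].

Definition state_potential st := potential (size (objects st)) (parts st).

Definition finish_cost n := n.+1 * (3 * log n + 64).

Lemma max_parts_le n : max_parts n <= n.+1.
Proof.
rewrite /max_parts geq_max andbT; case: n => // n.
apply: ltnW; apply: leq_trans (ltn_expl _ (isT : 1 < 2)) _.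
by apply: leqW; exact: trunc_logP.
Qed.

(** The bound 3 n + 2 on the edges fits a deletion: at most 2 (n + 1) old edges and at most n in the
    new graph. At most two merges follow, so 5 n + 2 edges bound the space before a possible
    rebuild. *)
Lemma spec_finish S ps :
  parts_inv d S ps -> proper ps -> size ps <= max_parts (size S) + 2 ->
  size (all_edges ps) <= 3 * size S + 2 ->
  spec (finish d S ps) (fun st t w =>
    [/\ objects st = S, state_inv st,
        t + state_potential st <= potential (size S) ps + finish_cost (size S)
      & w <= 20 * (size S).+1]).
Proof.
move=> psinv psprop psz psE; have [uS _ _] := psinv.
apply: (spec_bind (spec_merge psinv psprop psz)) => ps1 t1 w1.
have := max_parts_le (size S); move: psz psE.
set n := size S; set m := max_parts n => psz psE lem.
case=> inv1 [prop1 sz1] E1 t1_le w1_le.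
have km : size ps - m <= 2 by move: psz; move: (size ps); clear; lia.
have {}E1 : size (all_edges ps1) <= 5 * n + 2.
  apply: leq_trans E1 _; apply: (@leq_trans (3 * n + 2 + n * 2)); last by clear; lia.
  by rewrite leq_add // leq_mul2l km orbT.
have {}w1_le : w1 <= 14 * n.+1.
  apply: leq_trans w1_le _.
  have : n * (size ps - m) <= n * 2 by rewrite leq_mul2l km orbT.
  move: psz psE lem; move: (size ps) (size _) => k e; clear.
  by set x := n * _; lia.
have {}t1_le : t1 + potential n ps1 <= potential n ps + 3 * step_cost n.
  apply: leq_trans t1_le _; rewrite leq_add2l mulnC leq_mul2r.
  by rewrite ltnS km orbT.
apply: (spec_bind (P1 := fun ps2 t w =>
  [/\ parts_inv d S ps2, proper ps2 /\ size ps2 <= m,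
     size (all_edges ps2) <= 2 * n,
     t + potential n ps2 <= potential n ps1 + 20 * n.+1 & w <= 6 * n + 3])).
  apply: spec_tick; apply: spec_tick; apply: spec_tick.
  have sum_le : n.+1 + ((size ps1).+1 + (size (all_edges ps1)).+1) <= 9 * n.+1.
    move: sz1 E1 lem; rewrite -/m; move: (size ps1) (size _); clear; lia.
  case: ifP => [rebuild|/negbT].
    apply: spec_weaken (spec_single_part uS) _ => ps2 t w [inv2 [prop2 sz2]].
    case=> [E2 pot2] t_le w_le; split=> //.
    - by split=> //; apply: leq_trans sz2 _; rewrite leq_maxr.
    - by apply: leq_trans E2 _; rewrite -/n; clear; lia.
    - rewrite pot2 addn0; rewrite -/n in t_le rebuild.
      (* At a rebuild there are at least 2 n edges, n above the free allowance, and the potential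
         this represents pays for the quadratic construction. *)
      have : 48 * n.+1 * n <= potential n ps1.
        rewrite leq_mul2l; apply/orP; right; move: rebuild; clear.
        move: (size _) => e; lia.
      move: sum_le t_le; move: (size ps1) (size (all_edges ps1)) => a b.
      set c := potential n ps1; clear; nia.
  rewrite -ltnNge => /ltnW le2; apply: spec_ret; split=> //.
  move: sum_le; move: (size ps1) (size (all_edges ps1)) => a b.
  set c := potential n ps1; clear; lia.
move=> ps2 t2 w2 [inv2 [prop2 sz2] E2 t2_le w2_le].
apply: spec_weaken (spec_report inv2) _ => st t w [obj pa cp -> ->].
split=> //; rewrite ?wordsE.
- by split; rewrite ?obj ?pa.
- rewrite /state_potential obj pa -/n /finish_cost.
  move: t1_le t2_le sz2 lem E2; rewrite /step_cost.
  move: (size ps2) (size (all_edges ps2)) => a b.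
  move: (potential n ps1) (potential n ps2) (potential n ps) => c c2 c1.
  clear; lia.
- have [_ /perm_size -> _] := inv2; rewrite -/n.
  move: sz2 lem E2 w1_le w2_le; move: (size ps2) (size (all_edges ps2)) => a b.
  clear; lia.
Qed.

End Operations.

(** * Updates *)

Section Updates.

Context {T : eqType} {disp : Order.disp_t} {D : orderType disp}.
Variable d : T -> T -> D.
Hypothesis d_sym : forall s t, d s t = d t s.

Implicit Types (S : seq T) (ps : seq (part (T := T))) (st : state (T := T)).

Lemma max_parts_le_log n : max_parts n <= (log n).+1.
Proof. by rewrite /max_parts; clear; lia. Qed.

Lemma size_words S ps : parts_inv d S ps ->
  words S ps = 2 * size S + size (all_edges ps) + size ps + 1.
Proof.
case=> _ /perm_size szc _; rewrite wordsE szc.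
by move: (size ps) (size _) (size S); clear; lia.
Qed.

(** * Insertion *)

Lemma sub_graphs_inv S S' ps :
  {subset S <= S'} -> graphs_inv d S ps -> graphs_inv d S' ps.
Proof.
move=> sSS' [gr cov]; split=> // p /gr[uG GS]; split=> // e /GS[? ? ?].
by split=> //; exact: sSS'.
Qed.

(** The shifts by one make the bound valid for n = 0 and n = 1 too, where n log n vanishes. *)
Definition insert_cost n := 4000 * (n.+1 * (log n).+1).

(** Two effects add up: the bracket grows by O(log n) and is multiplied by 48 (n + 2), and the old
    bracket, at most 12 n (log n + 1), is counted 48 more times because the factor n + 1 has
    increased. *)
Lemma potential_insert n x G ps :
  weight ps <= sum_log n -> size (all_edges ps) <= 2 * n -> size G <= 2 ->
  potential n.+1 (([:: x : T], G) :: ps)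
    <= potential n ps + 1900 * (n.+1 * (log n).+1).
Proof.
move=> w_le E_le szG; rewrite /potential /weight big_cons /= -/(weight ps).
have -> : size (all_edges (([:: x], G) :: ps)) = size G + size (all_edges ps).
  by rewrite /all_edges /= size_cat.
rewrite [sum_log 1]sum_logS sum_log0 trunc_log1 !add0n.
rewrite sum_logS; have := trunc_logS_le n; have := sum_log_le n.
move: w_le E_le szG.
move: (log n.+1) (log n) (sum_log n) (weight ps) (size _) (size _).
move=> l' l f w g e w_le E_le szG f_le l_le.
have h1 : f + l' - w <= f - w + l.+1 by move: w_le l_le; clear; lia.
have h2 : g + e - n.+1 <= e - n + 1 by move: szG; clear; lia.
have h3 : 11 * (f + l' - w) + (g + e - n.+1) <=
    11 * (f - w) + (e - n) + (11 * l.+1 + 1).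
  by move: h1 h2; clear; lia.
have h4 : 11 * (f - w) + (e - n) <= 12 * (n * l.+1).
  by move: f_le E_le; clear; nia.
move: h3 h4; set a := _ + (g + e - n.+1); set b := 11 * (f - w) + (e - n).
clear; nia.
Qed.

Lemma finish_costS n : finish_cost n.+1 <= 134 * (n.+1 * (log n).+1).
Proof.
by rewrite /finish_cost; have := trunc_logS_le n; move: (log _) (log n); clear; nia.
Qed.

Lemma spec_insert x st :
  state_inv d st -> x \notin objects st ->
  spec (insert d x st) (fun st' t w => let n := size (objects st) in
    [/\ objects st' = x :: objects st, state_inv d st',
        t + state_potential st' <= state_potential st + insert_cost n
      & w <= 50 * n.+1]).
Proof.
case: st => S ps r [/= psinv psprop psz psE _] xS.
have [uS cS gr] := psinv; have wE := size_words psinv.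
have szn := max_parts_le (size S).
have uxS : uniq (x :: S) by rewrite /= xS.
apply: spec_tick; apply: (spec_framed_new_graph d_sym) => //.
  by move=> y; rewrite !inE => ->.
move=> G t w Gok /= t_le w_le.
have [uG GS szG _] := Gok; rewrite /= in szG.
have inv' : parts_inv d (x :: S) (([:: x], G) :: ps).
  apply: (parts_inv_cons d_sym) => //; first by rewrite /= perm_cons.
  by apply: sub_graphs_inv gr => y yS; rewrite inE yS orbT.
apply: spec_weaken (spec_finish d_sym inv' _ _ _) _ => //=.
- have : max_parts (size S) <= max_parts (size S).+1.
    by rewrite geq_max !leq_max leq_trunc_log ?leqnSn ?orbT.
  move: psz; move: (size ps); clear; lia.
- rewrite /all_edges /= size_cat -/(all_edges ps).
  by move: psE szG; clear; lia.
move=> st' t' w' [obj inv2 t'_le w'_le]; split=> //.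
- have := potential_insert x (weight_le_size psinv) psE szG.
  rewrite /state_potential /= /insert_cost; move: t'_le t_le.
  have := finish_costS (size S); rewrite /state_potential /=.
  set c := potential _ _; set c' := potential _ _; set c'' := potential _ _.
  have : size S + 1 <= (size S).+1 * (log (size S)).+1 by clear; nia.
  move: (_ * _) => X; clear; nia.
- have {w_le}: w <= (words S ps).+1 + (4 * (size S).+1).+1 by [].
  rewrite wE; move: w'_le psE psz szn; move: (size ps) (size (all_edges ps)).
  by clear; lia.
Qed.

(** * Deletion *)

Lemma weight_filter (P : pred T) f ps n :
  (forall p, p \in ps -> size p.1 <= n) ->
  weight ps + size [seq y <- classes ps | P y] * log n
    <= weight [seq ([seq y <- p.1 | P y], f p) | p <- ps]
       + size (classes ps) * log n.
Proof.
rewrite /weight /classes; elim: ps => [|p ps IHps] le_n.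
  by rewrite !big_nil.
rewrite /= !big_cons filter_cat !size_cat /= !mulnDl.
have pn := le_n p (mem_head _ _).
have : size [seq y <- p.1 | P y] <= size p.1 by rewrite size_filter count_size.
(* Each object removed from a class of at most n objects lowers the weight by at most log n. *)
move=> /leq_sum_log_sub/(_ pn); rewrite mulnBl.
have : size [seq y <- p.1 | P y] * log n <= size p.1 * log n.
  by rewrite leq_mul2r size_filter count_size orbT.
have := IHps (fun q qps => le_n q (mem_behead (s := p :: ps) qps)).
set a := bigop _ _ _; set b := bigop _ _ _; set c := _ * _; set e := _ * _.
by set g := _ * _; set h := _ * _; clear; lia.
Qed.

Definition delete_cost n := 4000 * (n.+1 * (log n).+1 ^ 2).

(* In-degrees are at most 1, so a graph has at most one edge into [x]. *)
Lemma size_predecessors S ps x :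
  parts_inv d S ps ->
  size [seq e.1 | e <- all_edges ps & e.2 == x] <= size ps.
Proof.
case=> _ _ [gr _]; rewrite size_map size_filter count_flatten sumnE -map_comp.
rewrite big_map -sum1_size big_seq [leqRHS]big_seq; apply: leq_sum => p /gr[up _].
have -> : (count (fun e => e.2 == x) \o snd) p = count_mem x [seq e.2 | e <- p.2].
  by rewrite count_map.
by rewrite count_uniq_mem // leq_b1.
Qed.

Definition prune x (Y : seq T) ps : seq (part (T := T)) :=
  [seq ([seq y <- p.1 | (y != x) && (y \notin Y)],
        [seq e <- p.2 | (e.1 != x) && (e.2 != x)]) | p <- ps].

Lemma classes_prune x Y ps :
  classes (prune x Y ps) =
  [seq y <- classes ps | (y != x) && (y \notin Y)].
Proof. by rewrite /classes filter_flatten -!map_comp. Qed.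

Lemma all_edges_prune x Y ps :
  all_edges (prune x Y ps) =
  [seq e <- all_edges ps | (e.1 != x) && (e.2 != x)].
Proof. by rewrite /all_edges filter_flatten -!map_comp. Qed.

(** The edge covering a surviving pair starts at a member of the pair, so not at [x]. If it ended at
    [x], its source would be in [Y], but the members of the pair are not. So no covering edge is
    lost. *)
Lemma graphs_inv_prune S ps x (Y : seq T) :
  graphs_inv d S ps ->
  (forall e, e \in all_edges ps -> e.2 = x -> e.1 \in Y) ->
  graphs_inv d [seq y <- S | y != x] (prune x Y ps).
Proof.
move=> [gr cov] YP; split=> [_ /mapP[p /gr[uG GS] ->] /=|].
  split=> [|e]; first by rewrite (subseq_uniq _ uG) // map_subseq // filter_subseq.
  rewrite [e \in _]mem_filter => /andP[/andP[e1 e2] /GS[? ? ?]].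
  by rewrite !mem_filter e1 e2; split.
move=> _ _ /mapP[p pps ->] /mapP[q qps ->] y z /=.
rewrite !mem_filter -!andbA => /and3P[yx yY yp] /and3P[zx zY zq] yz.
have [e epq /andP[e1 le_e]] := cov p q pps qps y z yp zq yz.
exists e; last by rewrite e1.
have eps : e \in all_edges ps.
  by move: epq; rewrite mem_cat => /orP[]; exact: mem_all_edges.
have e1x : e.1 != x by move: e1; rewrite !inE => /orP[] /eqP->.
have e2x : e.2 != x.
  apply: contraNneq yY => /(YP e eps); move: e1; rewrite !inE.
  by case/orP=> /eqP-> //; rewrite (negPf zY).
by rewrite mem_cat !mem_filter e1x e2x -mem_cat.
Qed.

(** The y objects of [Y] and [x] itself leave their classes, each at a loss of at most log n. The
    new graph adds at most 2 y edges, and the smaller n adds one to the excess. As y <= log n + 1,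
    the bracket grows by O(log^2 n), which is multiplied by 48 n. *)
Lemma potential_delete n m y x (Y : seq T) G ps :
  size (classes ps) = n -> m.+1 = n -> size Y = y ->
  size [seq z <- classes ps | (z != x) && (z \notin Y)] + y.+1 = n ->
  size G <= 2 * y -> y <= (log n).+1 ->
  (forall p, p \in ps -> size p.1 <= n) ->
  potential m (nonempty ((Y, G) :: prune x Y ps))
    <= potential n ps + 1900 * (n * (log n).+1 ^ 2).
Proof.
move=> szn mn szY szf szG y_le le_n; rewrite /potential weight_nonempty.
have := size_edges_nonempty ((Y, G) :: prune x Y ps).
have : size (all_edges ((Y, G) :: prune x Y ps)) <= size G + size (all_edges ps).
  rewrite /all_edges /= size_cat leq_add2l -/(all_edges _) all_edges_prune.
  by rewrite size_filter count_size.
have := weight_filter (fun z => (z != x) && (z \notin Y))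
  (fun p => [seq e <- p.2 | (e.1 != x) && (e.2 != x)]) le_n.
rewrite szn -/(prune x Y ps).
have -> : weight ((Y, G) :: prune x Y ps) = sum_log y + weight (prune x Y ps).
  by rewrite /weight big_cons /= szY.
have -> : n * log n
    = size [seq z <- classes ps | (z != x) && (z \notin Y)] * log n + y.+1 * log n.
  by rewrite -mulnDl szf.
have := sum_logS m; rewrite mn.
move: (weight ps) (weight (prune x Y ps)) (sum_log y) (sum_log m) (sum_log n).
move: (size (all_edges (nonempty _))) (size (all_edges (_ :: _))).
move: (size (all_edges _)) (size G) szG (_ * _) => e g szG u.
move=> e1 e2 w w1 sy sm sn sn_eq w_le e2_le e1_le.
have {w_le}w_le : w <= w1 + y.+1 * log n by move: w_le; clear; lia.
have h1 : sm - (sy + w1) <= sn - w + y.+1 * log n.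
  by move: sn_eq w_le; clear; lia.
have h2 : e1 - m <= e - n + (2 * y).+1.
  by move: e1_le e2_le szG mn; clear; lia.
have h3 : 11 * (sm - (sy + w1)) + (e1 - m)
    <= 11 * (sn - w) + (e - n) + (11 * (y.+1 * log n) + (2 * y).+1).
  by move: h1 h2; clear; lia.
have h4 : 11 * (y.+1 * log n) + (2 * y).+1 <= 25 * (log n).+1 ^ 2.
  by move: y_le; move: (log n); clear; nia.
move: h3 h4; set a := 11 * (sm - _) + _; set b := 11 * (sn - w) + _.
set c := (_ ^ 2); clear; nia.
Qed.

Lemma delete_time_le n l k e y2 ny t f t' p p' :
  k <= l.+1 -> e <= 2 * n -> y2 <= l.+1 ^ 2 -> ny <= n * l.+3 ->
  t <= 8 * n * l.+2 -> t' + p' <= p + 1900 * (n * l.+1 ^ 2) + f ->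
  f <= n * (3 * l.+1 + 64) ->
  k.+1 + (e.+1 + (y2 + (n.+1 + (ny + e + k + k + (t + t'))))) + p'
    <= p + 4000 * (n.+1 * l.+1 ^ 2).
Proof.
move=> k_le e_le y2_le ny_le t_le p_le f_le.
have l2 : l.+1 <= l.+1 ^ 2 by rewrite leq_pmulr.
have nl2 : n * l.+1 <= n * l.+1 ^ 2 by rewrite leq_mul2l l2 orbT.
have n2 : n <= n * l.+1 ^ 2 by rewrite leq_pmulr.
move: (l.+1 ^ 2) l2 nl2 n2 y2_le p_le => z l2 nl2 n2 y2_le p_le.
lia.
Qed.

Lemma spec_delete x st :
  state_inv d st -> x \in objects st ->
  spec (delete d x st) (fun st' t w => let n := size (objects st) in
    [/\ objects st' = [seq y <- objects st | y != x], state_inv d st',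
        t + state_potential st' <= state_potential st + delete_cost n
      & w <= 50 * n.+1]).
Proof.
case: st => S ps r [/= psinv psprop psz psE _] xS.
have [uS cS gr] := psinv; have wE := size_words psinv.
have szm := max_parts_le_log (size S); have szn := max_parts_le (size S).
have szys := size_predecessors x psinv.
rewrite /delete; apply: spec_tick; apply: spec_tick => /=.
set ys := map _ _ in szys *; set Y := undup ys.
rewrite -/(prune x Y ps).
have szY : size Y <= size ps by exact: leq_trans (size_undup _) szys.
have YP e : e \in all_edges ps -> e.2 = x -> e.1 \in Y.
  by move=> eE ex; rewrite mem_undup map_f // mem_filter ex eqxx.
set S' := [seq y <- S | y != x].
have sYS : {subset Y <= S'}.
  (* No edge is a loop, so a predecessor of [x] differs from [x]. *)
  move=> y; rewrite mem_undup => /mapP[e]; rewrite mem_filter => /andP[/eqP ex].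
  by move=> /(all_edges_in psinv)[e1 _]; rewrite ex mem_filter => ? ->; apply/andP.
have uS' : uniq S' by rewrite filter_uniq.
have szS' : (size S').+1 = size S := size_filter_neq uS xS.
have cS' : perm_eq (Y ++ classes (prune x Y ps)) S'.
  rewrite classes_prune; apply: uniq_perm => //.
    rewrite cat_uniq undup_uniq filter_uniq ?(perm_uniq cS) // andbT.
    by apply/hasPn => y; rewrite mem_filter -andbA => /and3P[].
  move=> y; rewrite mem_cat !mem_filter (perm_mem cS).
  have [yY|] := boolP (y \in Y); last by rewrite andbT.
  by have := sYS y yY; rewrite mem_filter => ->.
apply: spec_tick; apply: spec_hold; apply: spec_remove; rewrite -/S'.
apply: spec_tick; apply: (spec_framed_new_graph d_sym) => //.
  exact: undup_uniq.
move=> G t w Gok t_le w_le; have [uG GS szG _] := Gok.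
have szGS := size_edges uG GS.
have inv' : parts_inv d S' ((Y, G) :: prune x Y ps).
  by apply: (parts_inv_cons d_sym) => //; exact: graphs_inv_prune.
have szc : size [seq z <- classes ps | (z != x) && (z \notin Y)] + (size Y).+1
    = size S.
  by rewrite -szS' -(perm_size cS') classes_prune size_cat addnS addnC.
have szps' : size (nonempty ((Y, G) :: prune x Y ps)) <= (size ps).+1.
  by rewrite size_filter (leq_trans (count_size _ _)) //= size_map.
have szE' : size (all_edges (nonempty ((Y, G) :: prune x Y ps)))
    <= size G + size (all_edges ps).
  apply: leq_trans (size_edges_nonempty _) _.
  rewrite /all_edges /= size_cat leq_add2l -/(all_edges _) all_edges_prune.
  by rewrite size_filter count_size.
have logS : log (size S) <= (log (size S')).+1.
  by rewrite -szS'; exact: trunc_logS_le.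
have mp : max_parts (size S) <= (max_parts (size S')).+1.
  by move: logS; rewrite /max_parts; clear; lia.
apply: spec_weaken (spec_finish d_sym (parts_inv_nonempty inv') _ _ _) _.
- exact: proper_nonempty.
- by move: szps' psz mp; move: (size _) (size ps); clear; lia.
- move: szE' szGS psE; rewrite -szS'.
  by move: (size _) (size _) (size G) (size S'); clear; lia.
move=> st' t' w' [obj inv2 t'_le w'_le]; split=> //.
- have {t'_le} : t' + state_potential st' <= potential (size S) ps
      + 1900 * (size S * (log (size S)).+1 ^ 2) + finish_cost (size S').
    apply: leq_trans t'_le _; rewrite leq_add2r.
    apply: (potential_delete (perm_size cS) szS' erefl szc szG) => [|p pps].
      exact: leq_trans szY (leq_trans psz szm).
    rewrite -(perm_size cS) size_classes (big_rem p pps); exact: leq_addr.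
  have fin_le : finish_cost (size S') <= size S * (3 * (log (size S)).+1 + 64).
    rewrite /finish_cost szS' leq_mul2l; apply/orP; right.
    have : log (size S') <= log (size S) by rewrite leq_trunc_log // -szS'.
    by clear; lia.
  rewrite (sum_part_succ (fun p => (size p.1 * (size Y).+2 + size p.2).+1)).
  rewrite (sum_part_succ (fun p => size p.1 * (size Y).+2 + size p.2)).
  rewrite big_split -big_distrl /= (size_parts psinv) -size_all_edges.
  rewrite /state_potential /= /delete_cost.
  have {szm psz} k_le := leq_trans psz szm; rewrite szS' in t_le.
  have ys2 : size ys ^ 2 <= (log (size S)).+1 ^ 2.
    by rewrite leq_sqr; exact: leq_trans szys k_le.
  have {szY}y_le := leq_trans szY k_le.
  have nY : size S * (size Y).+2 <= size S * (log (size S)).+3.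
    by rewrite leq_mul2l !ltnS y_le orbT.
  have {}t_le : t <= 8 * size S * (log (size S)).+2.
    by apply: leq_trans t_le _; rewrite leq_mul2l !ltnS y_le orbT.
  move=> p_le; exact: (delete_time_le k_le psE ys2 nY t_le p_le fin_le).
- have wps : words S' (prune x Y ps) <= words S ps.
    rewrite !wordsE ltnS !leq_add -?szS' //.
    + rewrite classes_prune -(perm_size cS) in szc szS' *.
      by rewrite size_filter count_size.
    + by rewrite all_edges_prune size_filter count_size.
    + by rewrite size_map.
  move: w_le w'_le wps wE szS' psE psz szn szys.
  move: (words _ _) (words _ _) (size ps) (size ys) (size (all_edges ps)).
  by move: (size S') (size S); clear; lia.
Qed.

(** * Sequences of updates *)

Lemma spec_updates us S st :
  state_inv d st -> perm_eq (objects st) S -> all_admissible S us ->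
  spec (updates d us st) (fun st' t _ =>
    [/\ state_inv d st', perm_eq (objects st') (foldl apply S us)
      & t + state_potential st'
          <= state_potential st + budget insert_cost delete_cost S us]).
Proof.
elim: us S st => [|u us IHus] S st inv stS.
  by move=> _; apply: spec_ret; split=> //; rewrite addn0.
case/andP=> adm adms; have szS := perm_size stS.
have [uS _ _] : parts_inv d (objects st) (parts st) by case: inv.
have step : spec (update d u st) (fun st' t w =>
    [/\ state_inv d st', perm_eq (objects st') (apply S u)
      & t + state_potential st' <= state_potential st
          + (if u is Insert _ then insert_cost (size S) else delete_cost (size S))]).
  case: u adm {adms} => x; rewrite /= -(perm_mem stS) => adm.
    apply: spec_weaken (spec_insert inv adm) _ => st' t w [obj inv' t_le _].
    by split; rewrite -?szS // obj perm_cons.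
  apply: spec_weaken (spec_delete inv adm) _ => st' t w [obj inv' t_le _].
  split; rewrite -?szS // obj -rem_filter //.
  rewrite -(perm_cons x) -(permPl (perm_to_rem adm)) (permPl stS).
  by rewrite perm_to_rem -?(perm_mem stS).
apply: (spec_bind step) => st1 t1 w1 [inv1 st1S t1_le].
apply: spec_weaken (IHus _ _ inv1 st1S adms) _ => st2 t2 w2 [inv2 st2S t2_le].
split=> //=; move: t1_le t2_le.
move: (state_potential _) (state_potential _) (state_potential _) => a b c.
set e := budget _ _ _ _; set f := match u with Insert _ => _ | Delete _ => _ end.
by clear; lia.
Qed.

Lemma spec_init S :
  uniq S -> spec (init d S) (fun st _ w =>
    [/\ objects st = S, state_inv d st, state_potential st = 0
      & w <= 50 * (size S).+1]).
Proof.
move=> uS; apply: (spec_bind (spec_single_part d_sym uS)) => ps t w.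
case=> inv [prop szps] [E_le pot0] _ w_le.
apply: spec_weaken (spec_report inv) _ => st t' w' [obj pa cp _ ->].
split=> //.
- split; rewrite ?obj ?pa //.
    by apply: leq_trans szps _; rewrite leq_maxr.
  by apply: leq_trans E_le _; rewrite leq_pmull.
- by rewrite /state_potential obj pa.
- rewrite (size_words inv); move: w_le szps E_le.
  by move: (size ps) (size _) (size S); clear; lia.
Qed.

End Updates.

(** * The asymptotic bounds *)

Theorem theorem1 :
  exists space ins del : nat -> nat,
    [/\ bigO space (fun n => n),
        bigO ins (fun n => n * trunc_log 2 n),
        bigO del (fun n => n * trunc_log 2 n ^ 2)
      & forall (T : eqType) (disp : Order.disp_t) (D : orderType disp)
               (d : T -> T -> D) (S0 : seq T) (us : seq (operation (T := T))),
          (forall s t, d s t = d t s) ->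
          uniq S0 -> all_admissible S0 us ->
          init d S0 (fun st0 _ w0 =>
            w0 <= space (size S0) /\
            updates d us st0 (fun st time _ =>
              let S := foldl apply S0 us in
              [/\ perm_eq (objects st) S,
                  is_closest_pair d S (closest st),
                  time <= budget ins del S0 us,
                  words (objects st) (parts st) <= space (size S)
                & forall u, admissible S u ->
                    update d u st (fun _ _ w => w <= space (size S))]))].
Proof.
have lin n : 0 < n -> n.+1 <= 2 * n by lia.
(* From n = 2 on, log n is positive, so each shift by one costs a factor of 2: in all 4 for
   insertions, and 8 for deletions, where the logarithm is squared. *)
have lg n : 1 < n -> (log n).+1 <= 2 * log n.
  by move=> n1; have : 0 < log n; [rewrite trunc_log_gt0 | lia].
exists (fun n => 50 * n.+1), insert_cost, delete_cost; split.
- exists 100, 1 => n /lin; lia.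
- exists (4 * 4000), 2 => n n2; rewrite /insert_cost.
  have := leq_mul (lin n (ltnW n2)) (lg n n2).
  lia.
- exists (8 * 4000), 2 => n n2; rewrite /delete_cost.
  have l2 : (log n).+1 ^ 2 <= (2 * log n) ^ 2 by rewrite leq_sqr lg.
  have := leq_mul (lin n (ltnW n2)) l2.
  by rewrite expnMn; move: (_ ^ 2) (log n ^ 2); lia.
move=> T disp D d S0 us d_sym uS0 adm.
apply: (spec_init d_sym uS0) => st0 _ w0 [obj0 inv0 pot0 w0_le]; split=> //.
have st0S : perm_eq (objects st0) S0 by rewrite obj0.
apply: (spec_updates d_sym inv0 st0S adm) => st time _ [inv stS time_le] S.
have szS := perm_size stS; rewrite -/S in stS szS.
have [psinv psprop psz psE cp] := inv.
split=> //.
- move: cp; rewrite /is_closest_pair; case: (closest st) => [[s t]|]; last by rewrite szS.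
  case=> sS tS st_neq min; split; rewrite -?(perm_mem stS) // => x y.
  by rewrite -!(perm_mem stS); exact: min.
(* The initial potential is zero and the final one nonnegative, so the amortized costs bound the
   actual time. *)
- by move: time_le; rewrite pot0 add0n; apply: leq_trans; rewrite leq_addr.
- rewrite (size_words psinv) -szS; have := max_parts_le (size (objects st)).
  move: psz psE; move: (size (parts st)) (size (all_edges _)) (size (objects st)).
  by clear; lia.
case=> x /=; rewrite -(perm_mem stS) => xS.
  by apply: (spec_insert d_sym inv xS) => st' t w [_ _ _]; rewrite szS.
by apply: (spec_delete d_sym inv xS) => st' t w [_ _ _]; rewrite szS.
Qed.
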